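(* Let $G$ be a connected graph of order $n\ge 2$ and let $H$ be a non-trivial graph. The following are equivalent: (i) there exists a local adjacency basis $S$ for $H$ such that $S\not\subseteq N_H(v)$ for every $v\in V(H)\setminus S$; (ii) $\operatorname{dim}_{A,l}(G\odot H)=n\cdot \operatorname{dim}_{A,l}(H)$; (iii) $\operatorname{dim}_l(G\odot H)=\operatorname{dim}_{A,l}(G\odot H)$.
   Context: All graphs are finite, simple, undirected; non-trivial means order at least 2. For a connected graph with shortest-path distance $d$, a local metric generator is a vertex set $S$ such that every two adjacent vertices $x,y$ satisfy $d(s,x)\ne d(s,y)$ for some $s\in S$; $\operatorname{dim}_l$ is the minimum size of a local metric generator. A vertex set $S$ is a local adjacency generator of a graph if for every two adjacent vertices $x,y$ not in $S$ there exists $s\in S$ with $|N(s)\cap\{x,y\}|=1$ ($N$ the open neighbourhood); a local adjacency basis is one of minimum cardinality, and this cardinality is $\operatorname{dim}_{A,l}$. The corona product $G\odot H$ ($G$ of order $n$ with vertices $v_1,\dots,v_n$) consists of $G$ and $n$ disjoint copies $H_1,\dots,H_n$ of $H$, with $v_i$ joined to every vertex of $H_i$.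
   Formalization: The implication (iii) ⇒ (ii) is stated only for H with at least one edge, since it fails for edgeless H (e.g. G = K_2 and H two isolated vertices); (i) ⇔ (ii) and (ii) ⇒ (iii) are stated for every non-trivial H. *)

(* Defs.v *)
From HB Require Import structures.
From mathcomp Require Import all_boot.
Set Implicit Arguments. Unset Strict Implicit. Unset Printing Implicit Defensive.

Record sgraph := SGraph {
  vertex :> finType;
  adj : rel vertex;
  adj_sym : symmetric adj;
  adj_irr : irreflexive adj
}.

Section Graph.
Variable G : sgraph.
Implicit Types (x y s v : G) (S : {set G}).

Definition nbh v : {set G} := [set x | adj v x].

Definition connected_graph : Prop := forall x y, connect (@adj G) x y.

(* For an edgeless graph H on at least two vertices, the empty set is the only *)
(* local adjacency basis, and diml (corona G H) = dimAl (corona G H) does not  *)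
(* imply dimAl (corona G H) = #|G| * dimAl H: if G = K_2 and H is edgeless,    *)
(* then diml and dimAl of the corona are both 1 whereas dimAl H = 0.           *)
Definition has_edge : Prop := exists x y, adj x y.

Definition walk_of_length (k : nat) x y : bool :=
  [exists p : k.-tuple G, path (@adj G) x p && (last x p == y)].

(* Shortest walks have fewer than #|G| edges, so the search range is large     *)
(* enough; the value is #|G| when x and y lie in different components.         *)
Definition dist x y : nat :=
  find (fun k => walk_of_length k x y) (iota 0 #|G|).

Definition local_metric_generator S : bool :=
  [forall x, forall y, adj x y ==> [exists s in S, dist s x != dist s y]].

Definition local_adjacency_generator S : bool :=
  [forall x, forall y, [&& adj x y, x \notin S & y \notin S] ==>
     [exists s in S, #|nbh s :&: [set x; y]| == 1]].

Lemma local_metric_generatorT : local_metric_generator [set: G].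
Proof.
apply/forallP => x; apply/forallP => y; apply/implyP => xy.
have neq_xy : x != y by apply: contraTneq xy => <-; rewrite adj_irr.
apply/existsP; exists x; rewrite in_setT /dist /=.
have -> : #|G| = #|G|.-1.+1 by rewrite prednK //; apply/card_gt0P; exists x.
rewrite /=.
have -> : walk_of_length 0 x x.
  by apply/existsP; exists [tuple]; rewrite /= eqxx.
suff -> : walk_of_length 0 x y = false by [].
by apply/existsP => -[p]; rewrite tuple0 /= (negPf neq_xy).
Qed.

Lemma local_adjacency_generatorT : local_adjacency_generator [set: G].
Proof.
by apply/forallP => x; apply/forallP => y; rewrite !in_setT andbF.
Qed.

(* The minimum is attained because the full vertex set is a generator.         *)
Definition diml : nat :=
  #|[arg min_(S < [set: G] | local_metric_generator S) #|S|]|.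

Definition dimAl : nat :=
  #|[arg min_(S < [set: G] | local_adjacency_generator S) #|S|]|.

Definition local_adjacency_basis S : bool :=
  local_adjacency_generator S && (#|S| == dimAl).

End Graph.

Section Corona.
Variables G H : sgraph.

(* inl v is the vertex v of G, and inr (v, x) is the vertex x in the copy of H *)
(* attached to v.                                                              *)
Definition corona_vertex : finType := (G + G * H)%type.

Definition corona_adj (a b : corona_vertex) : bool :=
  match a, b with
  | inl u, inl v => adj u v
  | inl u, inr q => u == q.1
  | inr p, inl v => p.1 == v
  | inr p, inr q => (p.1 == q.1) && adj p.2 q.2
  end.

Lemma corona_adj_sym : symmetric corona_adj.
Proof.
move=> [u|[u x]] [v|[v y]] /=; rewrite 1?eq_sym //; first exact: adj_sym.
by rewrite adj_sym.
Qed.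

Lemma corona_adj_irr : irreflexive corona_adj.
Proof. by move=> [u|[u x]] /=; rewrite adj_irr ?andbF. Qed.

Definition corona : sgraph := SGraph corona_adj_sym corona_adj_irr.

End Corona.

(* Main.v *)
Require Import Defs.
From HB Require Import structures.
From mathcomp Require Import all_boot.
Set Implicit Arguments. Unset Strict Implicit. Unset Printing Implicit Defensive.

(* A vertex outside the i-th copy of H reaches that copy only through v_i, so  *)
(* it is equidistant from all vertices of the copy, while inside the copy all  *)
(* distances are at most 2 and are determined by adjacency. Hence the trace on *)
(* each copy of a local metric generator of the corona is a local adjacency    *)
(* generator of H, so that n dimAl(H) <= diml(corona) <= dimAl(corona).        *)
(* Copying a basis S of H into every copy resolves all edges by distance as    *)
(* soon as S is nonempty, so diml(corona) = n dimAl(H) when H has an edge. It  *)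
(* resolves all edges by adjacency when moreover S is contained in no N(v)     *)
(* with v outside S: the edge v_i x is then resolved by some s in the i-th     *)
(* copy of S not adjacent to x. Conversely, a generator of size n dimAl(H)     *)
(* has no vertex in G, and its trace on any copy is a basis as in (i).         *)

(** With $n$ the order of $G$, everything rests on the chain $n\cdot$[dimAl H] $\le$ [diml K] $\le$
    [dimAl K] for the corona [K]: the left inequality is [diml_corona_ge], via [trace_generator],
    and the right one is [diml_le_dimAl]. Equality on the left is [diml_corona]; it uses an edge of
    [H] so that a basis of [H] is nonempty. Equality of the two ends gives (iii) by squeezing, and
    amounts to (i) by [dimAl_corona_eq] and [dimAl_corona_basis]. *)

Section Generators.
Variable G : sgraph.
Implicit Types (x y s : G) (S : {set G}).

Lemma adj_neq x y : adj x y -> x != y.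
Proof. by apply: contraTneq => ->; rewrite adj_irr. Qed.

Lemma card_nbhI2 s x y : x != y ->
  (#|nbh s :&: [set x; y]| == 1) = (adj s x != adj s y).
Proof.
move=> neq_xy; rewrite setIUr cardsU -setIA.
have -> : [set x] :&: (nbh s :&: [set y]) = set0.
  apply/setP => z; rewrite !inE; apply/negP => /and3P[/eqP-> _].
  by rewrite (negPf neq_xy).
have card_nbhI1 z : #|nbh s :&: [set z]| = adj s z.
  have [sz|nsz] := boolP (adj s z).
    by rewrite (setIidPr _) ?cards1 // sub1set inE.
  by rewrite (_ : _ :&: _ = set0) ?cards0 //; apply/setP => t;
     rewrite !inE; apply/negP => /andP[st /eqP tz]; rewrite -tz st in nsz.
rewrite setI0 cards0 subn0 !card_nbhI1.
by case: (adj s x); case: (adj s y).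
Qed.

Lemma local_adjacency_generatorP S :
  reflect (forall x y, adj x y -> x \notin S -> y \notin S ->
             exists2 s, s \in S & adj s x != adj s y)
          (local_adjacency_generator S).
Proof.
apply: (iffP forallP) => [gS x y xy xS yS|gS x].
  move/forallP/(_ y)/implyP: (gS x); rewrite xy xS yS => /(_ isT).
  by case/exists_inP => s sS; rewrite card_nbhI2 ?adj_neq //; exists s.
apply/forallP => y; apply/implyP => /and3P[xy xS yS].
have [s sS sxy] := gS x y xy xS yS.
by apply/exists_inP; exists s; rewrite ?card_nbhI2 ?adj_neq.
Qed.

Lemma local_metric_generatorP S :
  reflect (forall x y, adj x y -> exists2 s, s \in S & dist s x != dist s y)
          (local_metric_generator S).
Proof.
apply: (iffP forallP) => [gS x y xy|gS x].
  by move/forallP/(_ y)/implyP: (gS x) => /(_ xy)/exists_inP.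
by apply/forallP => y; apply/implyP => /gS[s sS ?]; apply/exists_inP; exists s.
Qed.

(** * Comparing distances by transforming walks *)

Lemma walk_of_lengthP k x y :
  reflect (exists p, [/\ path (@adj G) x p, last x p = y & size p = k])
          (walk_of_length k x y).
Proof.
apply: (iffP existsP) => [[p /andP[xp /eqP]]|[p [xp pE <-]]].
  by exists p; rewrite size_tuple.
by exists (in_tuple p); rewrite xp pE eqxx.
Qed.

Lemma dist_le_card x y : dist x y <= #|G|.
Proof. by rewrite -[leqRHS](size_iota 0) find_size. Qed.

Lemma dist_le_size x p : path (@adj G) x p -> dist x (last x p) <= size p.
Proof.
(* Lengths of at least [#|G|] lie outside the search range of [dist], but its default value [#|G|]
   still satisfies the bound. *)
move=> xp; have [le_G|lt_p] := leqP #|G| (size p).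
  exact: leq_trans (dist_le_card _ _) le_G.
rewrite leqNgt; apply/negP => /(before_find 0).
rewrite nth_iota // add0n => /walk_of_lengthP; apply.
by exists p.
Qed.

Lemma dist_walk x y : dist x y < #|G| ->
  exists p, [/\ path (@adj G) x p, last x p = y & size p = dist x y].
Proof.
move=> lt_d; apply/walk_of_lengthP.
have := lt_d; rewrite -{1}(size_iota 0 #|G|) -has_find => /(nth_find 0).
by rewrite nth_iota.
Qed.

Lemma dist_lt_card x y : connect (@adj G) x y -> dist x y < #|G|.
Proof.
case/connectP => p0 /shortenP[p xp Up _] ->.
apply: leq_ltn_trans (dist_le_size xp) _.
by rewrite -ltnS -[(size p).+1]/(size (x :: p)) -(card_uniqP Up) ltnS max_card.
Qed.

Lemma dist_le_walk s x y :
    (forall p, path (@adj G) s p -> last s p = y ->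
       exists q, [/\ path (@adj G) s q, last s q = x & size q <= size p]) ->
  dist s x <= dist s y.
Proof.
move=> short; have [le_G|] := leqP #|G| (dist s y).
  exact: leq_trans (dist_le_card _ _) le_G.
case/dist_walk => p [sp py <-]; have [q [sq <- le_qp]] := short p sp py.
exact: leq_trans (dist_le_size sq) le_qp.
Qed.

(** Reachability of [x] matters when [y] is unreachable: otherwise both distances would take the
    default value [#|G|]. *)
Lemma dist_lt_walk s x y : connect (@adj G) s x ->
    (forall p, path (@adj G) s p -> last s p = y ->
       exists q, [/\ path (@adj G) s q, last s q = x & size q < size p]) ->
  dist s x < dist s y.
Proof.
move=> sx short; have [le_G|] := leqP #|G| (dist s y).
  exact: leq_trans (dist_lt_card sx) le_G.
case/dist_walk => p [sp py <-]; have [q [sq <- lt_qp]] := short p sp py.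
exact: leq_ltn_trans (dist_le_size sq) lt_qp.
Qed.

Lemma dist_self_lt x y : x != y -> dist x x < dist x y.
Proof.
move=> neq_xy; apply: dist_lt_walk => // -[|z p] xp /= yE.
  by rewrite yE eqxx in neq_xy.
by exists [::].
Qed.

(** A walk from [s] to [y] has at least two edges, while one edge leads to [x]. *)
Lemma dist_adj_lt s x y :
  s != y -> adj s x -> ~~ adj s y -> dist s x < dist s y.
Proof.
move=> neq_sy sx nsy; apply: dist_lt_walk; first exact: connect1.
move=> [|z [|t p]] /= sp yE; first by rewrite yE eqxx in neq_sy.
  by rewrite -yE (andP sp).1 in nsy.
by exists [:: x]; rewrite /= sx.
Qed.

Lemma adj_dist_neq s x y :
  x != s -> y != s -> adj s x != adj s y -> dist s x != dist s y.
Proof.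
move=> xs ys; case sx: (adj s x); case sy: (adj s y) => // _.
  by rewrite ltn_eqF // dist_adj_lt ?sy // eq_sym.
by rewrite gtn_eqF // dist_adj_lt ?sx // eq_sym.
Qed.

(** An endpoint in [S] resolves the pair itself, being at distance 0 only from itself; otherwise a
    difference in adjacency is a difference in distance. *)
Lemma local_resolved S x y : x != y ->
    (x \notin S -> y \notin S -> exists2 s, s \in S & adj s x != adj s y) ->
  exists2 s, s \in S & dist s x != dist s y.
Proof.
move=> neq_xy res; have [xS|xS] := boolP (x \in S).
  by exists x; rewrite // ltn_eqF // dist_self_lt.
have [yS|yS] := boolP (y \in S).
  by exists y; rewrite // gtn_eqF // dist_self_lt // eq_sym.
have [s sS sxy] := res xS yS.
exists s; rewrite // adj_dist_neq //.
  by apply: contraNneq xS => ->.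
by apply: contraNneq yS => ->.
Qed.

Lemma local_adjacency_metric_generator S :
  local_adjacency_generator S -> local_metric_generator S.
Proof.
move/local_adjacency_generatorP => gS; apply/local_metric_generatorP => x y xy.
by apply: local_resolved (gS x y xy); apply: adj_neq.
Qed.

Lemma dimAl_le S : local_adjacency_generator S -> dimAl G <= #|S|.
Proof.
rewrite /dimAl; case: arg_minnP; first exact: local_adjacency_generatorT.
by move=> B _ minB /minB.
Qed.

Lemma diml_le S : local_metric_generator S -> diml G <= #|S|.
Proof.
rewrite /diml; case: arg_minnP; first exact: local_metric_generatorT.
by move=> B _ minB /minB.
Qed.

Lemma dimAl_attained :
  exists2 S : {set G}, local_adjacency_generator S & #|S| = dimAl G.
Proof.
rewrite /dimAl; case: arg_minnP; first exact: local_adjacency_generatorT.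
by move=> B gB _; exists B.
Qed.

Lemma diml_attained :
  exists2 S : {set G}, local_metric_generator S & #|S| = diml G.
Proof.
rewrite /diml; case: arg_minnP; first exact: local_metric_generatorT.
by move=> B gB _; exists B.
Qed.

Lemma diml_le_dimAl : diml G <= dimAl G.
Proof.
have [S gS <-] := dimAl_attained.
exact/diml_le/local_adjacency_metric_generator.
Qed.

Lemma local_adjacency_generator_neq0 S :
  has_edge G -> local_adjacency_generator S -> S != set0.
Proof.
case=> x [y xy] /local_adjacency_generatorP gS; apply/eqP => S0.
by have [||s] := gS x y xy; rewrite S0 inE.
Qed.

End Generators.

(** * Distances in the corona and traces on the copies of [H] *)

Section Corona.
Variables G H : sgraph.
Local Notation K := (corona G H).
Implicit Types (u v : G) (x y z : H) (S : {set K}) (A : {set H}).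

Definition vtxG u : K := inl u.
Definition vtxH u x : K := inr (u, x).

Definition trace S u : {set H} := [set x | vtxH u x \in S].

Definition copies A : {set K} :=
  [set a : K | if a is inr p then p.2 \in A else false].

Lemma card_corona S :
  #|S| = #|[set u | vtxG u \in S]| + \sum_u #|trace S u|.
Proof.
rewrite -!sum1_card big_mkcond big_sumType /=; congr (_ + _).
  by rewrite [RHS]big_mkcond; apply: eq_bigr => u _; rewrite inE.
transitivity (\sum_u \sum_x (if vtxH u x \in S then 1 else 0)).
  by rewrite pair_bigA; apply: eq_bigr => -[].
apply: eq_bigr => u _; rewrite -sum1_card [RHS]big_mkcond.
by apply: eq_bigr => x _; rewrite inE.
Qed.

Lemma card_copies A : #|copies A| = #|G| * #|A|.
Proof.
rewrite card_corona (_ : [set u | _] = set0); last first.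
  by apply/setP => u; rewrite !inE.
rewrite cards0 -sum_nat_const; apply: eq_bigr => u _; congr #|pred_of_set _|.
by apply/setP => x; rewrite !inE.
Qed.

Definition in_copy u (a : K) : bool := if a is inr p then p.1 == u else false.

Lemma adj_in_copy u (a b : K) :
  adj a b -> ~~ in_copy u a -> in_copy u b -> a = vtxG u.
Proof.
case: a b => [w|[w x]] [w'|[w' y]] //=; first by move=> /eqP-> _ /eqP->.
by case/andP => /eqP-> _ /negPf->.
Qed.

(** The step that first enters the copy starts at [vtxG u], so the part of the walk before it is the
    required [q]. *)
Lemma walk_into_copy u (s : K) p :
    path (@adj K) s p -> ~~ in_copy u s -> in_copy u (last s p) ->
  exists q, [/\ path (@adj K) s q, last s q = vtxG u & size q < size p].
Proof.
elim: p s => [|a p IHp] s /=; first by move=> _ /negPf->.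
case/andP => sa ap su au; have [ua|nua] := boolP (in_copy u a).
  by exists [::]; rewrite (adj_in_copy sa su ua).
by have [q [aq qE lt_qp]] := IHp a ap nua au; exists (a :: q); rewrite /= sa.
Qed.

(** After reaching [vtxG u], a single edge leads to any vertex of the copy. Exchanging [x] and [y]
    yields equality. *)
Lemma dist_outside_le u (s : K) x y : ~~ in_copy u s ->
  dist s (vtxH u x) <= dist s (vtxH u y).
Proof.
move=> su; apply: dist_le_walk => p sp pE.
have [|q [sq qE lt_qp]] := walk_into_copy (u := u) sp su.
  by rewrite pE /= eqxx.
exists (rcons q (vtxH u x)); rewrite rcons_path last_rcons size_rcons sq qE.
by rewrite /= eqxx.
Qed.

(** Walks to [y] of length 0 are excluded by [z != y], those of length 1 transfer to [x] by equal
    adjacency, and longer ones are replaced by the detour of length 2 through [vtxG u]. *)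
Lemma dist_inside_le u x y z : z != y -> adj z x = adj z y ->
  dist (vtxH u z) (vtxH u x) <= dist (vtxH u z) (vtxH u y).
Proof.
move=> zy zxy; apply: dist_le_walk => -[|a [|b p]] sp pE.
- by case: pE zy => ->; rewrite eqxx.
- move: sp; rewrite /= in pE *; rewrite pE /= eqxx -zxy => /andP[zx _].
  by exists [:: vtxH u x]; rewrite /= eqxx zx.
by exists [:: vtxG u; vtxH u x]; rewrite /= !eqxx.
Qed.

Lemma trace_generator S u :
  local_metric_generator S -> local_adjacency_generator (trace S u).
Proof.
move/local_metric_generatorP => gS; apply/local_adjacency_generatorP.
move=> x y xy; rewrite !inE => xS yS.
have [|s sS] := gS (vtxH u x) (vtxH u y); first by rewrite /= eqxx.
have [|su] := boolP (in_copy u s); last first.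
  by rewrite eqn_leq !dist_outside_le.
case: s sS => // -[w z] sS /= /eqP wu; rewrite wu in sS *.
rewrite -/(vtxH u z) in sS *; move=> dist_neq.
exists z; rewrite ?inE //; apply: contraNneq dist_neq => zxy.
(* [z] differs from [x] and [y] because it lies in the trace and they do not. *)
by rewrite eqn_leq !dist_inside_le //;
   [apply: contraNneq xS | apply: contraNneq yS] => <-.
Qed.

Lemma dimAl_le_trace S u :
  local_metric_generator S -> dimAl H <= #|trace S u|.
Proof. by move=> /(trace_generator u)/dimAl_le. Qed.

Lemma diml_corona_ge : #|G| * dimAl H <= diml K.
Proof.
have [S gS <-] := diml_attained K; rewrite card_corona -sum_nat_const.
apply: leq_trans (leq_addl _ _); apply: leq_sum => u _.
exact: dimAl_le_trace.
Qed.

Lemma connect_corona u v :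
  connected_graph G -> connect (@adj K) (vtxG u) (vtxG v).
Proof.
move=> hG; case/connectP: (hG u v) => p up ->.
by apply/connectP; exists (map vtxG p); rewrite ?last_map // path_map.
Qed.

(** * The same generator placed in every copy of [H] *)

Section Copies.
Variable A : {set H}.
Hypotheses (gA : local_adjacency_generator A) (A0 : A != set0).

Lemma copies_resolve_copy u x y : adj x y ->
    vtxH u x \notin copies A -> vtxH u y \notin copies A ->
  exists2 s, s \in copies A & adj s (vtxH u x) != adj s (vtxH u y).
Proof.
rewrite !inE /= => xy xA yA.
have [z zA zxy] := local_adjacency_generatorP _ gA x y xy xA yA.
by exists (vtxH u z); rewrite ?inE //= eqxx.
Qed.

Lemma copies_resolve_base u v : adj u v ->
  exists2 s, s \in copies A & adj s (vtxG u) != adj s (vtxG v).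
Proof.
move=> /adj_neq uv; have /set0Pn[z zA] := A0.
by exists (vtxH u z); rewrite ?inE //= eqxx (negPf uv).
Qed.

Lemma copies_metric_generator :
  connected_graph G -> 2 <= #|G| -> local_metric_generator (copies A).
Proof.
move=> hG G2; apply/local_metric_generatorP.
(* The landmark is taken in the copy at another vertex [v]: its walks into the copy at [u] pass
   through [vtxG u] first. *)
have spoke u x :
    exists2 s, s \in copies A & dist s (vtxG u) < dist s (vtxH u x).
  have [v vu] : exists v, v != u.
    have /card_gt1P[v [w [_ _ vw]]] := G2.
    have [vu|] := eqVneq v u; last by exists v.
    by exists w; rewrite -vu eq_sym.
  have /set0Pn[z zA] := A0; exists (vtxH v z); first by rewrite inE.
  apply: dist_lt_walk => [|p sp pE].
    apply: connect_trans (connect_corona v u hG); apply: connect1.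
    by rewrite /= eqxx.
  by apply: (walk_into_copy sp); rewrite ?pE /= ?eqxx.
move=> [u|[u x]] [v|[v y]] ab; have neq_ab := adj_neq ab; move: ab => /= ab.
- by apply: (@local_resolved K) => // _ _; apply: copies_resolve_base.
- rewrite (eqP ab); have [s sA lt_d] := spoke v y.
  by exists s; rewrite // ltn_eqF.
- rewrite -(eqP ab); have [s sA lt_d] := spoke u x.
  by exists s; rewrite // gtn_eqF.
case/andP: ab neq_ab => /eqP<- xy neq_ab; apply: (@local_resolved K) => //.
exact: copies_resolve_copy.
Qed.

Lemma copies_adjacency_generator :
    (forall x, x \notin A -> ~~ (A \subset nbh x)) ->
  local_adjacency_generator (copies A).
Proof.
move=> A_nbh; apply/local_adjacency_generatorP.
(* A vertex of [A] not adjacent to [x], placed in the copy at [u], is adjacent to [vtxG u] but not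
   to [vtxH u x]. *)
have spoke u x : vtxH u x \notin copies A -> exists2 s,
    s \in copies A & adj s (vtxG u) != adj s (vtxH u x).
  rewrite inE => /A_nbh/subsetPn[z zA]; rewrite inE adj_sym => zx.
  by exists (vtxH u z); rewrite ?inE //= eqxx (negPf zx).
move=> [u|[u x]] [v|[v y]] /= ab aS bS.
- exact: copies_resolve_base.
- by rewrite (eqP ab); apply: spoke.
- by have [s sA] := spoke u x aS; exists s; rewrite // -(eqP ab) eq_sym.
case/andP: ab bS => /eqP<- xy bS; exact: copies_resolve_copy.
Qed.

End Copies.

(** * Values of the two dimensions and the condition on bases *)

Lemma diml_corona : connected_graph G -> 2 <= #|G| -> has_edge H ->
  diml K = #|G| * dimAl H.
Proof.
move=> hG G2 hH; apply/eqP; rewrite eqn_leq diml_corona_ge andbT.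
have [A gA <-] := dimAl_attained H; rewrite -card_copies; apply: diml_le.
exact/copies_metric_generator/G2/hG/(local_adjacency_generator_neq0 hH gA).
Qed.

Lemma dimAl_corona_ge : #|G| * dimAl H <= dimAl K.
Proof. exact: leq_trans diml_corona_ge (diml_le_dimAl K). Qed.

Lemma dimAl_corona_eq A : 0 < #|H| -> local_adjacency_basis A ->
    (forall x, x \notin A -> ~~ (A \subset nbh x)) ->
  dimAl K = #|G| * dimAl H.
Proof.
move=> /card_gt0P[x _] /andP[gA /eqP cardA] A_nbh.
apply/eqP; rewrite eqn_leq dimAl_corona_ge andbT -cardA -card_copies.
apply: dimAl_le; apply: copies_adjacency_generator => //.
(* An empty [A] would be contained in the neighbourhood of the vertex [x]. *)
apply: contraTneq isT => A0; rewrite A0 in A_nbh.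
by have := A_nbh x; rewrite inE sub0set => /(_ isT).
Qed.

Lemma dimAl_corona_basis : 0 < #|G| -> dimAl K = #|G| * dimAl H ->
  exists A : {set H}, local_adjacency_basis A /\
    (forall x, x \notin A -> ~~ (A \subset nbh x)).
Proof.
move=> /card_gt0P[u _] dimE; have [S gS cardS] := dimAl_attained K.
have mS := local_adjacency_metric_generator gS.
have := cardS; rewrite dimE card_corona -sum_nat_const => sumE.
have le_sum v : dimAl H <= #|trace S v| by apply: dimAl_le_trace.
(* The traces alone already account for the whole cardinality of [S], so nothing is left for [G],
   and no trace can exceed [dimAl H]. *)
have base0 : [set v | vtxG v \in S] = set0.
  apply/eqP; rewrite -cards_eq0 -leqn0 -(leq_add2r (\sum_v #|trace S v|)).
  by rewrite sumE; apply: leq_sum.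
have traceE : #|trace S u| = dimAl H.
  apply/eqP; rewrite eqn_leq le_sum andbT.
  move: sumE; rewrite base0 cards0 add0n (bigD1 u) //= [RHS](bigD1 u) //=.
  move=> sumE; rewrite -(leq_add2r (\sum_(v | v != u) #|trace S v|)) sumE.
  by rewrite leq_add2l; apply: leq_sum.
exists (trace S u); split.
  by rewrite /local_adjacency_basis trace_generator //= traceE.
move=> x; rewrite inE => xS.
have uS : vtxG u \notin S by have /setP/(_ u) := base0; rewrite !inE => ->.
(* The vertex resolving the edge from [vtxG u] to [vtxH u x] is not in [G], and in another copy it
   would be adjacent to neither end. In the copy at [u] it is adjacent to [vtxG u], hence not to
   [vtxH u x]: it witnesses that the trace is not inside [nbh x]. *)
have [|s sS sux] :=
  local_adjacency_generatorP _ gS (vtxG u) (vtxH u x) _ uS xS.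
  by rewrite /= eqxx.
case: s sS sux => [v vS|[v z] zS]; first by have /setP/(_ v) := base0;
  rewrite !inE /vtxG vS.
rewrite /=; have [vu zx|_] := eqVneq v u; last by rewrite eqxx.
apply/subsetPn; exists z; first by rewrite inE /vtxH -vu.
by rewrite inE adj_sym; case: (adj z x) zx.
Qed.

End Corona.

Theorem theorem24 (G H : sgraph) (n : nat)
    (hG : connected_graph G) (hn : #|G| = n) (hn2 : 2 <= n) (hH : 2 <= #|H|) :
  let cond_i := exists S : {set H}, local_adjacency_basis S /\
                  (forall v : H, v \notin S -> ~~ (S \subset nbh v)) in
  let cond_ii := dimAl (corona G H) = n * dimAl H in
  let cond_iii := diml (corona G H) = dimAl (corona G H) in
  (cond_i <-> cond_ii) /\ (cond_ii -> cond_iii) /\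
  (has_edge H -> cond_iii -> cond_ii).
Proof.
subst n; move=> cond_i cond_ii cond_iii; split; [split|split].
- by case=> A [bA A_nbh]; apply: dimAl_corona_eq bA A_nbh; apply: ltnW.
- by apply: dimAl_corona_basis; apply: ltnW.
- move=> ii; apply/eqP; rewrite eqn_leq diml_le_dimAl /= ii.
  exact: diml_corona_ge.
by move=> edgeH iii; rewrite /cond_ii -iii diml_corona.
Qed.
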